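(* Let the prior joint distribution of the losses $(X,Y)$ be bivariate normal with means $\mu_X,\mu_Y$, standard deviations $\sigma_X,\sigma_Y>0$ and correlation $\rho$ with $|\rho|<1$. Let $\sigma_1>0$, $\alpha\in(0,1)$, and let $\tilde\sigma_X^2$ denote the posterior variance of $X$ (under the entropy-pooling posterior described in the context). (i) Under the equality view $\tilde\sigma_X^2=\sigma_1^2$, $$\mathrm{CoVaR}_\alpha^{Y|\tilde\sigma_X^2=\sigma_1^2}=\mu_Y+\sigma_Y\left(1-\rho^2+\rho^2\frac{\sigma_1^2}{\sigma_X^2}\right)^{1/2}\Phi^{-1}(\alpha).$$ (ii) Under the inequality view $\tilde\sigma_X^2\le\sigma_1^2$: if $\sigma_X^2\le\sigma_1^2$, then $\mathrm{CoVaR}_\alpha^{Y|\tilde\sigma_X^2\le\sigma_1^2}=\mathrm{VaR}_\alpha^Y$; if $\sigma_X^2>\sigma_1^2$, then $\mathrm{CoVaR}_\alpha^{Y|\tilde\sigma_X^2\le\sigma_1^2}=\mathrm{CoVaR}_\alpha^{Y|\tilde\sigma_X^2=\sigma_1^2}$. (iii) Under the inequality view $\tilde\sigma_X^2\ge\sigma_1^2$: if $\sigma_X^2\ge\sigma_1^2$, then $\mathrm{CoVaR}_\alpha^{Y|\tilde\sigma_X^2\ge\sigma_1^2}=\mathrm{VaR}_\alpha^Y$; if $\sigma_X^2<\sigma_1^2$, then $\mathrm{CoVaR}_\alpha^{Y|\tilde\sigma_X^2\ge\sigma_1^2}=\mathrm{CoVaR}_\alpha^{Y|\tilde\sigma_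X^2=\sigma_1^2}$.
   Context: Entropy-pooling framework: given a ''view'' $V$ (a constraint on the posterior parameters), the posterior distribution of $(X,Y)$ is the bivariate normal distribution with means $\tilde\mu_X,\tilde\mu_Y$, standard deviations $\tilde\sigma_X,\tilde\sigma_Y>0$ and correlation $\tilde\rho\in(-1,1)$ that minimizes the relative entropy (Kullback–Leibler divergence) $\varepsilon(\tilde f,f)=\int \tilde f\,(\ln\tilde f-\ln f)$ of its density $\tilde f$ with respect to the prior density $f$, among all bivariate normal distributions satisfying $V$. The general CoVaR under view $V$ is $\mathrm{CoVaR}_\alpha^{Y|V}=\tilde\mu_Y+\tilde\sigma_Y\Phi^{-1}(\alpha)$ (the $\alpha$-quantile of the posterior marginal of $Y$), where $\Phi$ is the standard normal cdf. $\mathrm{VaR}_\alpha^Y=\mu_Y+\sigma_Y\Phi^{-1}(\alpha)$. *)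

(* Defs.v *)
From HB Require Import structures.
From mathcomp Require Import all_boot all_order all_algebra.
From mathcomp Require Import all_classical all_reals all_analysis.
Set Implicit Arguments. Unset Strict Implicit. Unset Printing Implicit Defensive.
Import Order.TTheory GRing.Theory Num.Theory.
Import numFieldNormedType.Exports.
Local Open Scope classical_set_scope.
Local Open Scope ring_scope.

Section EntropyPooling.
Variable R : realType.

Record bvn := BVN { muX : R; muY : R; sigX : R; sigY : R; rho : R }.

Definition bvn_adm (p : bvn) : Prop :=
  0 < sigX p /\ 0 < sigY p /\ -1 < rho p /\ rho p < 1.

Definition bvn_pdf (p : bvn) (z : R * R) : R :=
  let u := (z.1 - muX p) / sigX p in
  let v := (z.2 - muY p) / sigY p in
  (pi *+ 2 * sigX p * sigY p * Num.sqrt (1 - rho p ^+ 2))^-1 *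
  expR (- (u ^+ 2 - (rho p *+ 2) * u * v + v ^+ 2) / ((1 - rho p ^+ 2) *+ 2)).

Definition rel_entropy (pt p : bvn) : \bar R :=
  (\int[(@lebesgue_measure R) \x (@lebesgue_measure R)]_z
      (bvn_pdf pt z * (ln (bvn_pdf pt z) - ln (bvn_pdf p z)))%:E)%E.

Definition view := bvn -> Prop.

Definition is_EP_posterior (p : bvn) (V : view) (pt : bvn) : Prop :=
  bvn_adm pt /\ V pt /\
  forall q : bvn, bvn_adm q -> V q -> (rel_entropy pt p <= rel_entropy q p)%E.

Definition std_normal_cdf (x : R) : R :=
  fine (\int[(@lebesgue_measure R)]_(t in `]-oo, x]) (normal_pdf 0 1 t)%:E)%E.

Definition probit (alpha : R) : R :=
  xget 0 [set q : R | std_normal_cdf q = alpha].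

(* VaR of Y under parameters p (alpha-quantile of the marginal of Y). *)
Definition VaR_Y (alpha : R) (p : bvn) : R := muY p + sigY p * probit alpha.

Definition CoVaR_is (p : bvn) (V : view) (alpha c : R) : Prop :=
  (exists pt, is_EP_posterior p V pt) /\
  forall pt, is_EP_posterior p V pt -> VaR_Y alpha pt = c.

Definition view_var_eq (s1 : R) : view := fun pt => sigX pt ^+ 2 = s1 ^+ 2.
Definition view_var_le (s1 : R) : view := fun pt => sigX pt ^+ 2 <= s1 ^+ 2.
Definition view_var_ge (s1 : R) : view := fun pt => s1 ^+ 2 <= sigX pt ^+ 2.

End EntropyPooling.

(* Main.v *)
(* With [h x = (x^2 - 1)/2 - ln x], the chain rule for relative entropy gives
   [h (sigX q / sigX p) + h (sd_q(Y|X) / sd_p(Y|X)) + (sum of three squares) / 2], where the squares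
   measure the change of mean of [X] and of the two regression coefficients of [Y] on [X].
   Every view of the theorem constrains only the first term, and [h] is minimal at [1] and
   strictly monotone on either side of it, so the posterior keeps the regression of [Y] on [X]
   and moves [sigX] to the closest admissible value, which determines the posterior law of [Y].

   The Gaussian moments come from the fact that all normal densities integrate to 1:
   [1 + u <= expR u] bounds [normal_pdf (m + s d) (s k)] below by a quadratic polynomial times
   [normal_pdf m s], with equality at [d = 0], [k = 1], so the integrated inequality, as a function
   of [d] or of [k], is tangent there, which forces the first and second moments. *)
Require Import Defs.
From HB Require Import structures.
From mathcomp Require Import all_boot all_order all_algebra.
From mathcomp Require Import all_classical all_reals all_analysis.
From mathcomp Require Import measurable_realfun ring lra.
Set Implicit Arguments.
Unset Strict Implicit.
Import Order.TTheory GRing.Theory Num.Theory.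
Local Open Scope ring_scope.

(** * Integrable real functions with a known integral *)

Section HasIntegral.
Context d (T : measurableType d) (R : realType) (mu : {measure set T -> \bar R}).

(** Integrability and value travel together, so that linear combinations and comparisons of
    integrals need no side conditions later. *)
Definition has_integral (f : T -> R) (v : R) : Prop :=
  mu.-integrable setT (EFin \o f) /\ (\int[mu]_x (f x)%:E = v%:E)%E.

Lemma has_integral_ext f g v : f =1 g -> has_integral f v -> has_integral g v.
Proof. by move=> /funext ->. Qed.

Lemma has_integralD f g v w : has_integral f v -> has_integral g w ->
  has_integral (fun x => f x + g x) (v + w).
Proof.
move=> [fi fv] [gi gw]; split; first exact: (integrableD _ fi gi).
by under eq_integral do rewrite EFinD; rewrite integralD //= fv gw.
Qed.

Lemma has_integralZ c f v : has_integral f v ->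
  has_integral (fun x => c * f x) (c * v).
Proof.
move=> [fi fv]; split; first exact: (integrableZl _ c fi).
by under eq_integral do rewrite EFinM; rewrite integralZl //= fv.
Qed.

Lemma le_has_integral (f g : T -> R) v w : (forall x, f x <= g x) ->
  has_integral f v -> has_integral g w -> v <= w.
Proof.
move=> fg [fi fv] [gi gw]; rewrite -lee_fin -fv -gw.
by apply: le_integral => // x _; rewrite lee_fin.
Qed.

Lemma has_integral_dominated (f g : T -> R) w : measurable_fun setT f ->
  (forall x, `|f x| <= g x) -> has_integral g w -> exists v, has_integral f v.
Proof.
move=> mf fg [gi _].
have fi : mu.-integrable setT (EFin \o f).
  apply: le_integrable gi => //; first exact/measurable_EFinP.
  move=> x _ /=; rewrite lee_fin.
  exact: le_trans (fg x) (ler_norm _).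
exists (fine (\int[mu]_x (f x)%:E)); split=> //.
by rewrite fineK//; exact: (integrable_fin_num _ fi).
Qed.

Lemma ge0_has_integral (f : T -> R) v : measurable_fun setT f -> (forall x, 0 <= f x) ->
  (\int[mu]_x (f x)%:E = v%:E)%E -> has_integral f v.
Proof.
move=> mf f0 fv; split=> //; apply/integrableP; split; first exact/measurable_EFinP.
under eq_integral do rewrite /= ger0_norm//.
by rewrite fv ltry.
Qed.

End HasIntegral.

(** * First and second moments of the normal law *)

Section NormalMoments.
Context {R : realType}.
Variables (m s : R).
Hypothesis s_gt0 : 0 < s.
Local Notation mu := (@lebesgue_measure R).
Local Notation n := (normal_pdf m s).
Local Notation t := (fun x => (x - m) / s).

Lemma normal_pdf_exp (a b x : R) : 0 < b ->
  normal_pdf a b x = normal_peak b * expR (- ((x - a) / b) ^+ 2 / 2).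
Proof.
move=> b0; rewrite normal_pdfE ?gt_eqF// /normal_fun; congr (_ * expR _).
by field; rewrite ?gt_eqF.
Qed.

Lemma normal_peakE (b : R) : 0 < b -> normal_peak b = b^-1 * normal_peak 1 :> R.
Proof.
move=> b0; rewrite /normal_peak expr1n mul1r -mulrnAr sqrtrM ?sqr_ge0//.
by rewrite sqrtr_sqr gtr0_norm// invfM.
Qed.

Lemma has_integral_normal_pdf (a b : R) : has_integral mu (normal_pdf a b) 1.
Proof. by split; [exact: integrable_normal_pdf|exact: integral_normal_pdf]. Qed.

(** The factor [k] cancels the ratio of the two peaks. What remains is [n x * expR u], where [u] is
    the difference of the two exponents, quadratic in [t x]. *)
Lemma normal_pdf_tangent (d k x : R) : 0 < k ->
  n x * (1 + t x ^+ 2 / 2 - (t x - d) ^+ 2 / (2 * k ^+ 2)) <=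
  k * normal_pdf (m + s * d) (s * k) x.
Proof.
move=> k0; have sk0 : 0 < s * k by rewrite mulr_gt0.
rewrite !normal_pdf_exp// (normal_peakE s_gt0) (normal_peakE sk0).
have -> : k * ((s * k)^-1 * normal_peak 1 *
    expR (- ((x - (m + s * d)) / (s * k)) ^+ 2 / 2)) =
  s^-1 * normal_peak 1 * expR (- t x ^+ 2 / 2) *
    expR (t x ^+ 2 / 2 - (t x - d) ^+ 2 / (2 * k ^+ 2)).
  rewrite -[in RHS]mulrA -expRD.
  have -> : - t x ^+ 2 / 2 + (t x ^+ 2 / 2 - (t x - d) ^+ 2 / (2 * k ^+ 2)) =
      - ((x - (m + s * d)) / (s * k)) ^+ 2 / 2 by field; rewrite ?gt_eqF.
  by field; rewrite ?gt_eqF.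
apply: ler_wpM2l; last by rewrite -addrA expR_ge1Dx.
by rewrite !mulr_ge0 ?expR_ge0 ?normal_peak_ge0 ?invr_ge0 ?ltW.
Qed.

Lemma measurable_standardize : measurable_fun setT (fun x : measurableTypeR R => (x - m) / s).
Proof. by apply: measurable_funM => //; exact: measurable_funB. Qed.

Lemma measurable_normal_moment j :
  measurable_fun setT (fun x : measurableTypeR R => n x * t x ^+ j).
Proof.
apply: measurable_funM; first exact: measurable_normal_pdf.
by apply: measurable_funX; exact: measurable_standardize.
Qed.

Let tangent_integral d k := has_integralZ k
  (has_integral_normal_pdf (m + s * d) (s * k)).

Lemma has_integral_normal_pdf2 : has_integral mu (fun x => n x * t x ^+ 2) 1.
Proof.
have [v nv] : exists v, has_integral mu (fun x => n x * t x ^+ 2) v.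
  apply: has_integral_dominated (measurable_normal_moment 2) _
    (* The tangent bound at [d = 0], [k = 2] reads [n * (1 + 3 / 8 * t ^+ 2) <= 2 * normal_pdf m (2
       * s)], hence the constant [8 / 3]. *)
    (has_integralZ (8 / 3) (tangent_integral 0 2)) => x.
  rewrite ger0_norm ?(mulr_ge0 _ (sqr_ge0 _)) ?normal_pdf_ge0//.
  have := normal_pdf_tangent 0 x (ltr0Sn _ 1).
  have := normal_pdf_ge0 m s x; rewrite subr0; set T := t x ^+ 2; set N := n x.
  move=> N0; have -> : N * (1 + T / 2 - T / (2 * 2 ^+ 2)) = N + 3 / 8 * (N * T) by field.
  by lra.
have bound k : 0 < k -> 1 + (1 - (k ^+ 2)^-1) / 2 * v <= k.
  move=> k0; have := has_integralD (has_integral_normal_pdf m s)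
    (has_integralZ ((1 - (k ^+ 2)^-1) / 2) nv).
  rewrite -[leRHS]mulr1; move=> /le_has_integral; apply; last exact: (tangent_integral 0 k).
  move=> x; apply: le_trans (normal_pdf_tangent 0 x k0).
  by rewrite subr0 le_eqVlt; apply/orP; left; apply/eqP; field; rewrite ?gt_eqF.
suff -> : 1 = v by [].
(* The factor [k - 1] changes sign at 1, so the other factor, equal to [2 - 2 * v] at [k = 1], must
   vanish there. *)
have bound' k : 0 < k -> 0 <= (k - 1) * (2 * k ^+ 2 - (k + 1) * v).
  move=> k0; have := bound k k0; rewrite -subr_ge0.
  have -> : k - (1 + (1 - (k ^+ 2)^-1) / 2 * v) =
    (k - 1) * (2 * k ^+ 2 - (k + 1) * v) / (2 * k ^+ 2) by field; rewrite ?gt_eqF.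
  by rewrite pmulr_lge0// invr_gt0 mulr_gt0// exprn_gt0.
apply/eqP; rewrite eq_le; apply/andP; split; rewrite leNgt; apply/negP => v1.
(* If [v < 1], the second factor is still positive at [k = 1 - e], which contradicts [bound']; the
   bound [1 / 2] keeps [k] positive. The case [1 < v] is symmetric, with [k = 1 + e]. *)
- pose e := Num.min (1 / 2) ((1 - v) / 4).
  have [e0 e1 e2] : [/\ 0 < e, e <= 1 / 2 & e <= (1 - v) / 4].
    by rewrite lt_min !ge_min !lexx orbT; split=> //; apply/andP; split; lra.
  have := bound' (1 - e) ltac:(lra); have -> : 1 - e - 1 = - e by ring.
  rewrite mulNr oppr_ge0 pmulr_rle0//; nra.
- pose e := Num.min (1 / 2) ((v - 1) / 4).
  have [e0 e1 e2] : [/\ 0 < e, e <= 1 / 2 & e <= (v - 1) / 4].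
    by rewrite lt_min !ge_min !lexx orbT; split=> //; apply/andP; split; lra.
  have := bound' (1 + e) ltac:(lra); have -> : 1 + e - 1 = e by ring.
  rewrite pmulr_rge0//; nra.
Qed.

(** Integrability follows from [|t| <= 1 + t ^+ 2] and the second moment. The tangent bounds at
    [k = 1] integrate to [d * v <= d ^+ 2 / 2] for every real [d]. *)
Lemma has_integral_normal_pdf1 : has_integral mu (fun x => n x * t x) 0.
Proof.
have [v nv] : exists v, has_integral mu (fun x => n x * t x ^+ 1) v.
  apply: has_integral_dominated (measurable_normal_moment 1) _
    (has_integralD (has_integral_normal_pdf m s) has_integral_normal_pdf2) => x.
  rewrite expr1 normrM ger0_norm ?normal_pdf_ge0//.
  rewrite -[X in _ <= X + _]mulr1 -mulrDr ler_wpM2l ?normal_pdf_ge0// ler_norml.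
  set T := t x; have := sqr_ge0 (T - 1); have := sqr_ge0 (T + 1); have := sqr_ge0 T.
  by rewrite sqrrB1 sqrrD1 => *; apply/andP; split; lra.
have bound d : d * v <= d ^+ 2 / 2.
  have := has_integralD (has_integralZ (1 - d ^+ 2 / 2) (has_integral_normal_pdf m s))
    (has_integralZ d nv).
  move=> /le_has_integral/(_ (tangent_integral d 1)).
  suff le_tangent : forall x, (1 - d ^+ 2 / 2) * n x + d * (n x * t x ^+ 1) <=
      1 * normal_pdf (m + s * d) (s * 1) x by move=> /(_ le_tangent); lra.
  move=> x; apply: le_trans (normal_pdf_tangent d x ltr01).
  by rewrite le_eqVlt; apply/orP; left; apply/eqP; field; rewrite gt_eqF.
(* At [d = v] the bound reads [v ^+ 2 <= v ^+ 2 / 2]. *)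
have v0 : v = 0 by have := bound v; nra.
by rewrite v0 in nv; apply: has_integral_ext nv => x; rewrite expr1.
Qed.

Lemma has_integral_normal_pdf_quadratic (a b c : R) :
  has_integral mu (fun x => n x * (a + b * t x + c * t x ^+ 2)) (a + c).
Proof.
have := has_integralD
  (has_integralD
    (has_integralZ a (has_integral_normal_pdf m s))
    (has_integralZ b has_integral_normal_pdf1))
  (has_integralZ c has_integral_normal_pdf2).
rewrite !mulr1 mulr0 addr0; apply: has_integral_ext => x; ring.
Qed.

End NormalMoments.

(** * Regression form of the bivariate normal density and closed form of the relative entropy *)

Section BivariateNormal.
Context {R : realType}.
Local Notation mu := (@lebesgue_measure R).
Implicit Type p q : bvn R.

(* The regression line [E(Y|X = x) = muY + slope * (x - muX)] and the standard deviation of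
   [Y] given [X]. *)
Definition slope p := sigY p * rho p / sigX p.
Definition cond_sd p := sigY p * Num.sqrt (1 - rho p ^+ 2).
Definition cond_mean p (x : R) := muY p + slope p * (x - muX p).

Lemma subr1_rho_gt0 p : bvn_adm p -> 0 < 1 - rho p ^+ 2.
Proof. by case=> _ [_ [r1 r2]]; nra. Qed.

Lemma cond_sd_gt0 p : bvn_adm p -> 0 < cond_sd p.
Proof.
move=> adm; have [_ [sY _]] := adm.
by rewrite mulr_gt0// sqrtr_gt0 subr1_rho_gt0.
Qed.

(** Complete the square in the second standardized variable: [v - rho * u], divided by
    [sqrt (1 - rho ^+ 2)], is the standardized residual of [Y] after regression on [X]. *)
Lemma bvn_pdf_exp p z : bvn_adm p -> bvn_pdf p z =
  (pi *+ 2 * (sigX p * cond_sd p))^-1 *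
  expR (- (((z.1 - muX p) / sigX p) ^+ 2 +
           ((z.2 - cond_mean p z.1) / cond_sd p) ^+ 2) / 2).
Proof.
move=> adm; have r0 := subr1_rho_gt0 adm; have [sX [sY _]] := adm.
rewrite /bvn_pdf /cond_mean /cond_sd /slope; congr (_^-1 * expR _); first by ring.
have t2 : Num.sqrt (1 - rho p ^+ 2) ^+ 2 = 1 - rho p ^+ 2 by rewrite sqr_sqrtr// ltW.
have t0 : 0 < Num.sqrt (1 - rho p ^+ 2) by rewrite sqrtr_gt0.
set t := Num.sqrt _ in t2 t0 *; rewrite -t2.
have -> : rho p *+ 2 = 2 * rho p by ring.
set u := (z.1 - muX p) / sigX p.
have -> : (z.2 - (muY p + sigY p * rho p / sigX p * (z.1 - muX p))) / (sigY p * t) =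
  ((z.2 - muY p) / sigY p - rho p * u) / t by rewrite /u; field; rewrite !gt_eqF.
set v := (z.2 - muY p) / sigY p.
have -> : u ^+ 2 - 2 * rho p * u * v + v ^+ 2 = t ^+ 2 * u ^+ 2 + (v - rho p * u) ^+ 2.
  by rewrite t2; ring.
by field; rewrite gt_eqF.
Qed.

(** Marginal of [X] times conditional law of [Y] given [X]: this lets the double integrals be
    computed one variable at a time. *)
Lemma bvn_pdf_factor p x y : bvn_adm p -> bvn_pdf p (x, y) =
  normal_pdf (muX p) (sigX p) x * normal_pdf (cond_mean p x) (cond_sd p) y.
Proof.
move=> adm; have [sX _] := adm; have sc := cond_sd_gt0 adm.
rewrite bvn_pdf_exp//= !normal_pdf_exp// (normal_peakE sX) (normal_peakE sc).
have -> : normal_peak 1 = (Num.sqrt (pi *+ 2))^-1 :> R.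
  by rewrite /normal_peak expr1n mul1r.
set u := (x - muX p) / sigX p; set w := (y - cond_mean p x) / cond_sd p.
have -> : - (u ^+ 2 + w ^+ 2) / 2 = - u ^+ 2 / 2 + - w ^+ 2 / 2 by ring.
rewrite expRD.
have pi2 : 0 < pi *+ 2 :> R by rewrite mulrn_wgt0// pi_gt0.
rewrite -[in LHS](@sqr_sqrtr R (pi *+ 2)) ?ltW//.
have : 0 < Num.sqrt (pi *+ 2) :> R by rewrite sqrtr_gt0.
set q := Num.sqrt _ => q0.
by field; rewrite !gt_eqF.
Qed.

Lemma bvn_pdf_gt0 p z : bvn_adm p -> 0 < bvn_pdf p z.
Proof.
move=> adm; have [sX _] := adm; have sc := cond_sd_gt0 adm.
have pi2 : 0 < pi *+ 2 :> R by rewrite mulrn_wgt0// pi_gt0.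
by rewrite bvn_pdf_exp// mulr_gt0 ?expR_gt0// invr_gt0 mulr_gt0// mulr_gt0.
Qed.

Lemma ln_bvn_pdf p z : bvn_adm p -> ln (bvn_pdf p z) =
  - ln (pi *+ 2) - ln (sigX p) - ln (cond_sd p)
  - (((z.1 - muX p) / sigX p) ^+ 2 + ((z.2 - cond_mean p z.1) / cond_sd p) ^+ 2) / 2.
Proof.
move=> adm; have [sX _] := adm; have sc := cond_sd_gt0 adm.
have pi2 : 0 < pi *+ 2 :> R by rewrite mulrn_wgt0// pi_gt0.
have sXc : 0 < sigX p * cond_sd p by rewrite mulr_gt0.
have D0 : 0 < pi *+ 2 * (sigX p * cond_sd p) by rewrite mulr_gt0.
rewrite bvn_pdf_exp// lnM ?posrE ?expR_gt0 ?invr_gt0// expRK lnV ?posrE//.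
rewrite (lnM _ _) ?posrE// (@lnM _ (sigX p)) ?posrE//.
by rewrite mulNr; ring.
Qed.

Local Notation R2 := (measurableTypeR R * measurableTypeR R)%type.

Lemma measurable_affine2 (a b c : R) :
  measurable_fun setT (fun z : R2 => a + b * z.1 + c * z.2).
Proof.
apply: measurable_funD.
  by apply: measurable_funD => //; apply: measurable_funM.
by apply: measurable_funM.
Qed.

Lemma measurable_bvn_pdf p : bvn_adm p -> measurable_fun setT (bvn_pdf p : R2 -> R).
Proof.
move=> adm; have [sX _] := adm; have sc := cond_sd_gt0 adm.
have -> : bvn_pdf p = (fun z : R2 =>
  (pi *+ 2 * (sigX p * cond_sd p))^-1 *
  expR (- 2^-1 * ((- (muX p / sigX p) + (sigX p)^-1 * z.1 + 0 * z.2) ^+ 2 +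
           (- ((muY p - slope p * muX p) / cond_sd p) + - (slope p / cond_sd p) * z.1
             + (cond_sd p)^-1 * z.2) ^+ 2))).
  apply/funext => z; rewrite bvn_pdf_exp//; congr (_ * expR _); rewrite /cond_mean.
  by field; rewrite !gt_eqF.
apply: measurable_funM => //; apply: measurableT_comp => //.
apply: measurable_funM => //.
by apply: measurable_funD; apply: measurable_funX; exact: measurable_affine2.
Qed.

(** Standardized [X] and the standardized residual of [Y] are uncorrelated with mean 0 and variance
    1. Only squares are integrated, so the integrand is nonnegative and Tonelli applies without
    prior integrability. *)
Lemma has_integral_bvn_pdf p (a b c : R) : bvn_adm p ->
  has_integral (mu \x mu)%E (fun z : R2 => bvn_pdf p z *
    (a + b * ((z.1 - muX p) / sigX p) + c * ((z.2 - cond_mean p z.1) / cond_sd p)) ^+ 2)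
  (a ^+ 2 + b ^+ 2 + c ^+ 2).
Proof.
move=> adm; have [sX _] := adm; have sc := cond_sd_gt0 adm.
set f := fun z => _.
have f0 z : 0 <= f z by rewrite mulr_ge0 ?sqr_ge0// ltW// bvn_pdf_gt0.
have mf : measurable_fun setT (f : R2 -> R).
  apply: measurable_funM; first exact: measurable_bvn_pdf.
  apply: measurable_funX.
  have -> : (fun z : R2 => a + b * ((z.1 - muX p) / sigX p) +
      c * ((z.2 - cond_mean p z.1) / cond_sd p)) = (fun z : R2 =>
      (a - b * (muX p / sigX p) - c * ((muY p - slope p * muX p) / cond_sd p))
      + (b / sigX p - c * (slope p / cond_sd p)) * z.1 + c / cond_sd p * z.2).
    by apply/funext => z; rewrite /cond_mean; field; rewrite !gt_eqF.
  exact: measurable_affine2.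
apply: ge0_has_integral => //.
rewrite fubini_tonelli1//=; last exact/measurable_EFinP.
rewrite /fubini_F.
have inner x : (\int[mu]_y (f (x, y))%:E = (normal_pdf (muX p) (sigX p) x *
    ((a ^+ 2 + c ^+ 2) + 2 * a * b * ((x - muX p) / sigX p)
     + b ^+ 2 * ((x - muX p) / sigX p) ^+ 2))%:E)%E.
  set A := a + b * ((x - muX p) / sigX p).
  have [_] := has_integralZ (normal_pdf (muX p) (sigX p) x)
    (has_integral_normal_pdf_quadratic (cond_mean p x) sc (A ^+ 2) (2 * A * c) (c ^+ 2)).
  have -> : normal_pdf (muX p) (sigX p) x * (A ^+ 2 + c ^+ 2) =
    normal_pdf (muX p) (sigX p) x *
    ((a ^+ 2 + c ^+ 2) + 2 * a * b * ((x - muX p) / sigX p)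
     + b ^+ 2 * ((x - muX p) / sigX p) ^+ 2) by rewrite /A; ring.
  move=> <-; apply: eq_integral => y _; congr (_%:E).
  by rewrite /f bvn_pdf_factor//= -/A; ring.
under eq_integral do rewrite inner.
have [_ ->] := has_integral_normal_pdf_quadratic (muX p) sX (a ^+ 2 + c ^+ 2) (2 * a * b) (b ^+ 2).
by congr (_%:E); ring.
Qed.

(* The relative entropy of [N(0, x^2)] with respect to [N(0, 1)]. *)
Definition scale_entropy (x : R) := (x ^+ 2 - 1) / 2 - ln x.

Lemma rel_entropyE q p : bvn_adm q -> bvn_adm p -> rel_entropy q p =
  (scale_entropy (sigX q / sigX p) + scale_entropy (cond_sd q / cond_sd p) +
   (((muX q - muX p) / sigX p) ^+ 2 +
    ((muY q - cond_mean p (muX q)) / cond_sd p) ^+ 2 +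
    ((slope q - slope p) * sigX q / cond_sd p) ^+ 2) / 2)%:E.
Proof.
move=> admq admp; have [sXq _] := admq; have [sXp _] := admp.
have scq := cond_sd_gt0 admq; have scp := cond_sd_gt0 admp.
pose K := ln (sigX p) + ln (cond_sd p) - ln (sigX q) - ln (cond_sd q).
pose d := (muX q - muX p) / sigX p.
pose k := sigX q / sigX p.
pose a := (muY q - cond_mean p (muX q)) / cond_sd p.
pose b := (slope q - slope p) * sigX q / cond_sd p.
pose c := cond_sd q / cond_sd p.
(* The log-ratio is the constant [K], minus half the two squares of [q], plus half those of [p]. The
   standardized variables of [p] are affine in those of [q], with coefficients [d, k] and
   [a, b, c]. *)
have := has_integralD
  (has_integralD (has_integralZ K (has_integral_bvn_pdf 1 0 0 admq))
    (has_integralZ (- 2^-1) (has_integralD (has_integral_bvn_pdf 0 1 0 admq)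
      (has_integral_bvn_pdf 0 0 1 admq))))
  (has_integralZ 2^-1 (has_integralD (has_integral_bvn_pdf d k 0 admq)
      (has_integral_bvn_pdf a b c admq))).
move=> [_ I]; rewrite /rel_entropy.
transitivity (K * (1 ^+ 2 + 0 ^+ 2 + 0 ^+ 2) +
        - 2^-1 * (0 ^+ 2 + 1 ^+ 2 + 0 ^+ 2 + (0 ^+ 2 + 0 ^+ 2 + 1 ^+ 2)) +
        2^-1 * (d ^+ 2 + k ^+ 2 + 0 ^+ 2 + (a ^+ 2 + b ^+ 2 + c ^+ 2)))%:E; last first.
  congr (_%:E); rewrite /scale_entropy !ln_div ?posrE// -/d -/a -/b -/k -/c /K.
  by field.
rewrite -I; apply: eq_integral => z _; congr (_%:E).
rewrite !ln_bvn_pdf//.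
have -> : (z.1 - muX p) / sigX p = d + k * ((z.1 - muX q) / sigX q).
  by rewrite /d /k; field; rewrite !gt_eqF.
have -> : (z.2 - cond_mean p z.1) / cond_sd p = a + b * ((z.1 - muX q) / sigX q)
    + c * ((z.2 - cond_mean q z.1) / cond_sd q).
  by rewrite /a /b /c /cond_mean; field; rewrite !gt_eqF.
by rewrite /K; field; rewrite !gt_eqF.
Qed.

End BivariateNormal.

(** * Strict monotonicity of the scale entropy on either side of 1 *)

Section ScaleEntropy.
Context {R : realType}.
Implicit Types x k : R.

Lemma ln_sqr_lt x : 0 < x -> x != 1 -> ln x < (x ^+ 2 - 1) / 2.
Proof.
move=> x0 x1.
have /expR_gt1Dx : ln (x ^+ 2) != 0.
  rewrite ln_eq0 ?exprn_gt0// sqrf_eq1 negb_or x1.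
  by rewrite gt_eqF// (lt_trans _ x0)// oppr_lt0.
rewrite lnK ?posrE ?exprn_gt0// lnXn// => ?; lra.
Qed.

Lemma scale_entropy1 : scale_entropy (1 : R) = 0.
Proof. by rewrite /scale_entropy ln1 expr1n subrr mul0r subr0. Qed.

(** The sign condition places [k0] between 1 and [k], possibly at 1. Divided by [k0 ^+ 2], it gives
    [(k / k0) ^+ 2 - 1 <= k ^+ 2 - k0 ^+ 2], to be combined with the strict logarithm bound at
    [k / k0]. *)
Lemma scale_entropy_lt k0 k : 0 < k0 -> 0 < k -> k != k0 ->
  0 <= (k ^+ 2 - k0 ^+ 2) * (k0 ^+ 2 - 1) -> scale_entropy k0 < scale_entropy k.
Proof.
move=> k00 kp kk0 H.
have kd : 0 < k / k0 by rewrite divr_gt0.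
have /(ln_sqr_lt kd) : k / k0 != 1.
  by apply: contra kk0 => /eqP kk; rewrite -(divfK (lt0r_neq0 k00) k) kk mul1r.
rewrite ln_div ?posrE//.
have : 0 <= (k ^+ 2 - k0 ^+ 2) * (k0 ^+ 2 - 1) / k0 ^+ 2.
  by rewrite divr_ge0// exprn_ge0// ltW.
have -> : (k ^+ 2 - k0 ^+ 2) * (k0 ^+ 2 - 1) / k0 ^+ 2 =
  k ^+ 2 - k0 ^+ 2 + 1 - (k / k0) ^+ 2 by field; rewrite gt_eqF.
rewrite /scale_entropy => ? ?; lra.
Qed.

Lemma scale_entropy_ge0 k : 0 < k -> 0 <= scale_entropy k.
Proof.
move=> k0; have [->|k1] := eqVneq k 1; first by rewrite scale_entropy1.
rewrite -[leLHS]scale_entropy1 ltW// scale_entropy_lt//.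
by rewrite expr1n subrr mulr0.
Qed.

Lemma scale_entropy_eq0 k : 0 < k -> scale_entropy k <= 0 -> k = 1.
Proof.
move=> k0; apply: contraTeq => k1; rewrite -ltNge -[ltLHS]scale_entropy1.
by rewrite scale_entropy_lt// expr1n subrr mulr0.
Qed.

End ScaleEntropy.

(** * The minimizer and its uniqueness *)

Section Posterior.
Context {R : realType}.
Variable p : bvn R.
Hypothesis adm_p : bvn_adm p.
Variable k : R.
Hypothesis k_gt0 : 0 < k.

Definition rescaled_sdY := sigY p * Num.sqrt (1 - rho p ^+ 2 + rho p ^+ 2 * k ^+ 2).

(* The prior with the marginal of [X] rescaled by [k] about its mean and the conditional law
   of [Y] given [X] unchanged. *)
Definition rescaled_bvn := BVN (muX p) (muY p) (k * sigX p) rescaled_sdY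
  (slope p * (k * sigX p) / rescaled_sdY).

Let sX0 : 0 < sigX p. Proof. by case: adm_p. Qed.
Let sY0 : 0 < sigY p. Proof. by case: adm_p => _ []. Qed.

Lemma rescaled_var_gt0 : 0 < 1 - rho p ^+ 2 + rho p ^+ 2 * k ^+ 2.
Proof. by rewrite ltr_wpDr ?subr1_rho_gt0// mulr_ge0// sqr_ge0. Qed.

Lemma rescaled_sdY_gt0 : 0 < rescaled_sdY.
Proof. by rewrite mulr_gt0// sqrtr_gt0 rescaled_var_gt0. Qed.

(** The law of total variance; it also recovers [sigY] of any posterior from its regression data. *)
Lemma sqr_rescaled_sdY :
  rescaled_sdY ^+ 2 = cond_sd p ^+ 2 + (slope p * (k * sigX p)) ^+ 2.
Proof.
rewrite !exprMn !sqr_sqrtr ?ltW ?rescaled_var_gt0 ?subr1_rho_gt0// /slope.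
by field; rewrite gt_eqF.
Qed.

Lemma slope_rescaled : slope rescaled_bvn = slope p.
Proof.
rewrite {1}/slope /=; field.
by rewrite !gt_eqF// ?rescaled_sdY_gt0.
Qed.

Lemma subr1_rho_rescaled :
  1 - rho rescaled_bvn ^+ 2 = (cond_sd p / rescaled_sdY) ^+ 2.
Proof.
rewrite /= !expr_div_n sqr_rescaled_sdY; field.
by rewrite -sqr_rescaled_sdY expf_eq0/= gt_eqF// rescaled_sdY_gt0.
Qed.

Lemma cond_sd_rescaled : cond_sd rescaled_bvn = cond_sd p.
Proof.
have c0 := cond_sd_gt0 adm_p; have s0 := rescaled_sdY_gt0.
rewrite {1}/cond_sd subr1_rho_rescaled sqrtr_sqr ger0_norm ?divr_ge0 ?ltW//=.
by rewrite mulrC divfK// gt_eqF.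
Qed.

Lemma rescaled_bvn_adm : bvn_adm rescaled_bvn.
Proof.
have : 0 < 1 - rho rescaled_bvn ^+ 2.
  by rewrite subr1_rho_rescaled exprn_gt0// divr_gt0 ?cond_sd_gt0 ?rescaled_sdY_gt0.
move=> r0; split; first exact: mulr_gt0.
split; first exact: rescaled_sdY_gt0.
by split; nra.
Qed.

Lemma rel_entropy_rescaled : rel_entropy rescaled_bvn p = (scale_entropy k)%:E.
Proof.
rewrite rel_entropyE//; last exact: rescaled_bvn_adm.
rewrite slope_rescaled cond_sd_rescaled /cond_mean /=.
rewrite mulfK ?gt_eqF// divff ?gt_eqF ?cond_sd_gt0// scale_entropy1 !subrr.
by rewrite !(mulr0, mul0r, addr0, subrr) expr0n/= !(mulr0, mul0r, addr0).
Qed.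

(* The side condition on [V] says that [k] is the point closest to [1] among the values that
   [V] allows for [sigX q / sigX p]. *)
Lemma posterior_rescaled (V : view R) :
  V rescaled_bvn ->
  (forall q, bvn_adm q -> V q ->
     0 <= ((sigX q / sigX p) ^+ 2 - k ^+ 2) * (k ^+ 2 - 1)) ->
  is_EP_posterior p V rescaled_bvn /\
  forall q, is_EP_posterior p V q -> sigY q = rescaled_sdY /\ muY q = muY p.
Proof.
move=> Vk Hk.
have gap q : bvn_adm q -> V q -> scale_entropy k <= scale_entropy (sigX q / sigX p).
  move=> admq Vq; have [->//|kq] := eqVneq (sigX q / sigX p) k.
  by rewrite ltW// scale_entropy_lt ?Hk// divr_gt0//; case: admq.
have rest q : bvn_adm q -> 0 <= scale_entropy (cond_sd q / cond_sd p).
  by move=> admq; rewrite scale_entropy_ge0// divr_gt0 ?cond_sd_gt0.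
split.
  split; first exact: rescaled_bvn_adm.
  split=> // q admq Vq; rewrite rel_entropy_rescaled rel_entropyE// lee_fin.
  rewrite -[leLHS]addr0 lerD ?mulr_ge0 ?invr_ge0//; last by rewrite !addr_ge0 ?sqr_ge0.
  by rewrite -[leLHS]addr0 lerD ?gap ?rest.
(* Uniqueness: each term of the entropy of [q] is at least its value at [rescaled_bvn], while the
   sum is at most [scale_entropy k], so every term attains its bound. *)
move=> q [admq [Vq /(_ _ rescaled_bvn_adm Vk)]].
have [sXq [sYq _]] := admq.
rewrite rel_entropy_rescaled rel_entropyE// lee_fin.
have := rest q admq; have := gap q admq Vq.
set hk := scale_entropy k; set hx := scale_entropy (_ / sigX p).
set hc := scale_entropy _; set d := _ / sigX p; set a := _ / cond_sd p.
set b := _ / cond_sd p => H1 H2 H3.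
have := sqr_ge0 d; have := sqr_ge0 a; have := sqr_ge0 b => Hb Ha Hd.
have c1 : cond_sd q / cond_sd p = 1.
  by apply: scale_entropy_eq0; rewrite ?divr_gt0 ?cond_sd_gt0//; rewrite -/hc; lra.
have k1 : sigX q / sigX p = k.
  apply/eqP; apply: contraT => kk.
  have := scale_entropy_lt k_gt0 (divr_gt0 sXq sX0) kk (Hk q admq Vq).
  by rewrite -/hx -/hk; lra.
have sp0 := cond_sd_gt0 adm_p.
have d0 : muX q = muX p.
  have /eqP : d ^+ 2 = 0 by lra.
  by rewrite sqrf_eq0 mulf_eq0 invr_eq0 (gt_eqF sX0) orbF subr_eq0 => /eqP.
have b0 : slope q = slope p.
  have /eqP : b ^+ 2 = 0 by lra.
  rewrite sqrf_eq0 !mulf_eq0 invr_eq0 (gt_eqF sXq) (gt_eqF sp0) !orbF.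
  by rewrite subr_eq0 => /eqP.
have a0 : muY q = muY p.
  have /eqP : a ^+ 2 = 0 by lra.
  rewrite sqrf_eq0 !mulf_eq0 invr_eq0 (gt_eqF sp0) !orbF /cond_mean d0.
  by rewrite subrr mulr0 addr0 subr_eq0 => /eqP.
split=> //.
have sXE : sigX q = k * sigX p by rewrite -k1 divfK// gt_eqF.
have cE : cond_sd q = cond_sd p by rewrite -[LHS](divfK (lt0r_neq0 sp0)) c1 mul1r.
apply/eqP; rewrite -(@eqrXn2 _ 2) ?ltW ?rescaled_sdY_gt0// sqr_rescaled_sdY.
rewrite -b0 -cE -sXE exprMn sqr_sqrtr ?ltW ?subr1_rho_gt0// /slope.
by apply/eqP; field; rewrite gt_eqF.
Qed.

Lemma CoVaR_rescaled (V : view R) (alpha : R) :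
  (forall q, sigX q = k * sigX p -> V q) ->
  (forall q, bvn_adm q -> V q ->
     0 <= ((sigX q / sigX p) ^+ 2 - k ^+ 2) * (k ^+ 2 - 1)) ->
  CoVaR_is p V alpha (muY p + rescaled_sdY * probit alpha).
Proof.
move=> Vk Hk; have [post uniq] := posterior_rescaled (Vk rescaled_bvn erefl) Hk.
split; first by exists rescaled_bvn.
by move=> q /uniq[sE mE]; rewrite /VaR_Y sE mE.
Qed.

End Posterior.

(** * CoVaR under the three variance views *)

Theorem theorem3p2 (R : realType) (mX mY sX sY r s1 alpha : R) :
  0 < sX -> 0 < sY -> -1 < r -> r < 1 -> 0 < s1 -> 0 < alpha -> alpha < 1 ->
  let prior := BVN mX mY sX sY r in
  let c_eq := mY + sY * Num.sqrt (1 - r ^+ 2 + r ^+ 2 * (s1 ^+ 2 / sX ^+ 2))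
                  * probit alpha in
  (* (i) *)
  CoVaR_is prior (view_var_eq s1) alpha c_eq /\
  (* (ii) *)
  (sX ^+ 2 <= s1 ^+ 2 -> CoVaR_is prior (view_var_le s1) alpha (VaR_Y alpha prior)) /\
  (s1 ^+ 2 < sX ^+ 2 -> CoVaR_is prior (view_var_le s1) alpha c_eq) /\
  (* (iii) *)
  (s1 ^+ 2 <= sX ^+ 2 -> CoVaR_is prior (view_var_ge s1) alpha (VaR_Y alpha prior)) /\
  (sX ^+ 2 < s1 ^+ 2 -> CoVaR_is prior (view_var_ge s1) alpha c_eq).
Proof.
move=> sX0 sY0 r1 r2 s10 _ _ prior c_eq.
have adm : bvn_adm prior by [].
have sX2 : 0 < sX ^+ 2 by rewrite exprn_gt0.
have k0 : 0 < s1 / sX by rewrite divr_gt0.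
have eqE : c_eq = muY prior + rescaled_sdY prior (s1 / sX) * probit alpha.
  by rewrite /c_eq /rescaled_sdY /= expr_div_n.
have varE : VaR_Y alpha prior = muY prior + rescaled_sdY prior 1 * probit alpha.
  by rewrite /rescaled_sdY expr1n mulr1 subrK sqrtr1 mulr1.
have sE : s1 / sX * sX = s1 by rewrite divfK// gt_eqF.
have ratio q : (sigX q / sX) ^+ 2 - (s1 / sX) ^+ 2 = (sigX q ^+ 2 - s1 ^+ 2) / sX ^+ 2.
  by field; rewrite gt_eqF.
have ratio1 : (s1 / sX) ^+ 2 - 1 = (s1 ^+ 2 - sX ^+ 2) / sX ^+ 2.
  by field; rewrite gt_eqF.
(* Take [k = s1 / sX] for the equality view and whenever the prior violates the inequality view.
   Take [k = 1] when the prior satisfies it; the factor [k ^+ 2 - 1] is then 0. *)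
split.
  rewrite eqE; apply: CoVaR_rescaled => // q; first by rewrite /= sE /view_var_eq => ->.
  by rewrite /view_var_eq => _ qE; rewrite /= ratio qE subrr mul0r mul0r.
split=> [le1|].
  rewrite varE; apply: CoVaR_rescaled => // q; first by rewrite /view_var_le mul1r => ->.
  by rewrite expr1n subrr mulr0.
split=> [lt1|].
  rewrite eqE; apply: CoVaR_rescaled => // q; first by rewrite /= sE /view_var_le => ->.
  rewrite /view_var_le => _ qle; rewrite /= ratio ratio1 mulr_le0//.
    by rewrite pmulr_lle0 ?invr_gt0// subr_le0.
  by rewrite pmulr_lle0 ?invr_gt0// subr_le0 ltW.
split=> [le1|lt1].
  rewrite varE; apply: CoVaR_rescaled => // q; first by rewrite /view_var_ge mul1r => ->.
  by rewrite expr1n subrr mulr0.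
rewrite eqE; apply: CoVaR_rescaled => // q; first by rewrite /= sE /view_var_ge => ->.
rewrite /view_var_ge => _ qge; rewrite /= ratio ratio1 mulr_ge0//.
  by rewrite divr_ge0 ?subr_ge0// ltW.
by rewrite divr_ge0 ?subr_ge0// ltW.
Qed.
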